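(* Let $G_1$ be an $r_1$-regular graph on $n_1$ vertices and $m_1$ edges, and $G_2$ an arbitrary graph on $n_2$ vertices. Then $$\begin{aligned}\phi\left(Q(G_1\underline{\vee} G_2);x\right)={}&(x-2-n_2)^{m_1-n_1}\cdot\prod_{i=1}^{n_2}\Big(x-m_1-\nu_i(G_2)\Big)\\&\cdot\prod_{i=1}^{n_1-1}\Big(x^2-(2+r_1+n_2)x+r_1n_2+2r_1-\nu_i(G_1)\Big)\\&\cdot\Big(x^2-(2+r_1+n_2)x+r_1n_2-m_1(x-r_1)\cdot\Gamma_{Q(G_2)}(x-m_1)\Big).\end{aligned}$$
   Context: All graphs are finite, simple and undirected, with at least one vertex. For a graph $G$ on $n$ vertices, $Q(G)=D(G)+A(G)$ is its signless Laplacian matrix ($D(G)$ the diagonal matrix of vertex degrees, $A(G)$ the adjacency matrix), with eigenvalues $\nu_1(G)\le\nu_2(G)\le\cdots\le\nu_n(G)$. For an $n\times n$ matrix $M$, $\phi(M;x)=\det(xI_n-M)$, and the $M$-coronal is the rational function $\Gamma_M(x)=\mathbf{1}_n^T(xI_n-M)^{-1}\mathbf{1}_n$ (the sum of the entries of $(xI_n-M)^{-1}$), where $\mathbf{1}_n$ is the all-ones column vector. The subdivision graph $\mathcal{S}(G)$ is obtained from $G$ by inserting a new vertex into every edge of $G$; $I(G)$ denotes the set of inserted vertices. For vertex-disjoint graphs $G_1,G_2$, the subdivision-edge join $G_1\underline{\vee}G_2$ is the graph obtained from $\mathcal{S}(G_1)$ and $G_2$ by joining every vertex of $I(G_1)$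 with every vertex of $V(G_2)$. The identity is understood as an identity of rational functions in $x$ (the exponent $m_1-n_1$ may be negative). *)

(* Defs.v *)
From HB Require Import structures.
From mathcomp Require Import all_boot all_order all_algebra.
From mathcomp Require Export fraction.
From mathcomp Require Import polyrcf.

Set Implicit Arguments.
Unset Strict Implicit.
Unset Printing Implicit Defensive.

Import Order.TTheory GRing.Theory Num.Theory.
Local Open Scope ring_scope.

Notation "p %:F" := (tofrac p) : ring_scope.

(* The condition that a graph has at least one vertex is not part of the
   record; it is a hypothesis wherever it is needed. *)
Record sgraph := SGraph {
  vertex :> finType;
  adj : rel vertex;
  adj_sym : symmetric adj;
  adj_irrefl : irreflexive adj }.

Definition edges (G : sgraph) : {set {set G}} :=
  [set [set p.1; p.2] | p : G * G & adj p.1 p.2].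

Definition edge (G : sgraph) : finType := {e : {set G} | e \in edges G}.

Definition degree (G : sgraph) (v : G) : nat := #|[set w | adj v w]|.

Definition regular (G : sgraph) (r : nat) : Prop := forall v : G, degree v = r.

(* Vertices of the subdivision graph: [inl v] is an original vertex and
   [inr e] is the vertex inserted into the edge [e]. *)
Definition subdivision_adj (G : sgraph) : rel (G + edge G) :=
  fun a b => match a, b with
  | inl v, inr e | inr e, inl v => v \in val e
  | _, _ => false
  end.

Lemma subdivision_sym (G : sgraph) : symmetric (@subdivision_adj G).
Proof. by move=> [v|e] [w|f]. Qed.

Lemma subdivision_irrefl (G : sgraph) : irreflexive (@subdivision_adj G).
Proof. by move=> [v|e]. Qed.

Definition subdivision (G : sgraph) : sgraph :=
  SGraph (@subdivision_sym G) (@subdivision_irrefl G).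

Definition inserted (G : sgraph) : pred (subdivision G) :=
  fun a => if a is inr _ then true else false.

Definition sejoin_adj (G1 G2 : sgraph) : rel (subdivision G1 + G2) :=
  fun a b => match a, b with
  | inl s, inl t => adj s t
  | inr v, inr w => adj v w
  | inl s, inr _ | inr _, inl s => inserted s
  end.

Lemma sejoin_sym (G1 G2 : sgraph) : symmetric (@sejoin_adj G1 G2).
Proof. by case=> [s|v] [t|w] //; [apply: (adj_sym s t)|apply: (adj_sym v w)]. Qed.

Lemma sejoin_irrefl (G1 G2 : sgraph) : irreflexive (@sejoin_adj G1 G2).
Proof. by case=> [s|v]; [apply: (adj_irrefl s)|apply: (adj_irrefl v)]. Qed.

Definition subdivision_edge_join (G1 G2 : sgraph) : sgraph :=
  SGraph (@sejoin_sym G1 G2) (@sejoin_irrefl G1 G2).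

Definition adjacency_mx (R : nzRingType) (G : sgraph) : 'M[R]_(#|G|) :=
  \matrix_(i, j) (adj (enum_val i) (enum_val j))%:R.

Definition degree_mx (R : nzRingType) (G : sgraph) : 'M[R]_(#|G|) :=
  diag_mx (\row_i (degree (enum_val i))%:R).

Definition signless_laplacian (R : nzRingType) (G : sgraph) : 'M[R]_(#|G|) :=
  degree_mx R G + adjacency_mx R G.

(* Only the eigenvalues lying in [R] are listed; for a symmetric [M], such as
   a signless Laplacian, these are all [n] of them. *)
Definition eigenvalues (R : rcfType) (n : nat) (M : 'M[R]_n) : seq R :=
  sort <=%R
    (flatten [seq nseq (mup x (char_poly M)) x | x <- rootsR (char_poly M)]).

(* The i-th smallest signless Laplacian eigenvalue, counting from i = 0. *)
Definition nu (R : rcfType) (G : sgraph) (i : nat) : R :=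
  (eigenvalues (signless_laplacian R G))`_i.

(* The value of the coronal of [M] at the point [y] of the field R(x) of
   rational functions.  The coronal itself is the case y = 'X%:F; substituting
   x - c for x in it is the case y = 'X%:F - c.  The matrix y - M is
   invertible for every non-constant [y]. *)
Definition coronal (R : fieldType) (n : nat) (M : 'M[R]_n)
    (y : {fraction {poly R}}) : {fraction {poly R}} :=
  let one : 'cV[{fraction {poly R}}]_n := const_mx 1 in
  let MF := map_mx (fun c : R => c%:P%:F) M in
  (one^T *m invmx (y%:M - MF) *m one) 0 0.

(* Main.v *)
(* Order the vertices of the join as I(G1), V(G1), V(G2), put a = x - r1,
   b = x - 2 - n2, C = x - m1 - Q(G2), and let B be the incidence matrix of G1,
   so that B B^T = Q(G1).  A Schur complement with respect to the last two blocks
   gives phi = a^n1 det(C) det(b - a^-1 B^T B - c J), where c is the coronal of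
   Q(G2) at x - m1.  As B^T B has constant row sums 2 r1, the term c J costs
   only a scalar factor, and Sylvester's identity replaces B^T B by Q(G1) at the
   price of a power of b.  The factor ab - 2 r1 of det(ab - Q(G1)) belonging to the
   largest eigenvalue 2 r1 of Q(G1) absorbs the denominator of the scalar factor. *)
Require Import Defs.
From mathcomp Require Import all_boot all_order all_algebra.
From mathcomp Require Import perm sesquilinear spectral complex polyrcf ring.

Import Order.TTheory GRing.Theory Num.Theory.
Local Open Scope ring_scope.

(** * Determinants of block matrices and of low-rank perturbations *)

Lemma det_schur (F : fieldType) (m n : nat) (A : 'M[F]_m) (B : 'M_(m, n))
    (C : 'M_(n, m)) (D : 'M_n) :
  D \in unitmx ->
  \det (block_mx A B C D) = \det D * \det (A - B *m invmx D *m C).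
Proof.
move=> uD.
have -> : block_mx A B C D =
    block_mx (A - B *m invmx D *m C) (B *m invmx D) 0 1%:M
      *m block_mx 1%:M 0 C D.
  rewrite mulmx_block !(mulmx1, mulmx0, mul1mx, mul0mx, add0r, addr0).
  by rewrite subrK mulmxKV.
by rewrite det_mulmx det_ublock det_lblock !det1 mulr1 mul1r mulrC.
Qed.

(** Both sides are the determinant of one block matrix with identity diagonal blocks and
    off-diagonal blocks [A], [B], factored once as upper times lower triangular and once as lower
    times upper. *)
Lemma det_sylvester (R : comNzRingType) (m n : nat) (A : 'M[R]_(m, n))
    (B : 'M_(n, m)) :
  \det (1%:M - A *m B) = \det (1%:M - B *m A).
Proof.
have E1 : block_mx 1%:M A B 1%:M =
    block_mx (1%:M - A *m B) A 0 1%:M *m block_mx 1%:M 0 B 1%:M.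
  rewrite mulmx_block !(mulmx1, mulmx0, mul1mx, mul0mx, add0r, addr0).
  by rewrite subrK.
have E2 : block_mx 1%:M A B 1%:M =
    block_mx 1%:M 0 B 1%:M *m block_mx 1%:M A 0 (1%:M - B *m A).
  rewrite mulmx_block !(mulmx1, mulmx0, mul1mx, mul0mx, add0r, addr0).
  by rewrite addrC subrK.
move: (congr1 determinant E1); rewrite {1}E2 !det_mulmx !det_ublock !det_lblock.
by rewrite !det1 !mulr1 !mul1r => <-.
Qed.

(** Pulling [b] out of each determinant leaves the two sides of Sylvester's identity. The powers
    pulled out are [b ^ m] and [b ^ n], and [m - n] may be negative, hence the integer exponent. *)
Lemma det_scalar_sub_mulmxC (F : fieldType) (m n : nat) (A : 'M[F]_(m, n))
    (B : 'M_(n, m)) (b : F) :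
  b != 0 ->
  \det (b%:M - A *m B) = b ^ (m%:Z - n%:Z) * \det (b%:M - B *m A).
Proof.
move=> b0.
have scale k (M : 'M[F]_k) : b%:M - M = b *: (1%:M - b^-1 *: M).
  by rewrite scalerBr scalerA divff // scale1r scalemx1.
rewrite !scale !detZ scalemxAl det_sylvester -scalemxAr mulrA.
by rewrite !exprnP -expfzDr // subrK.
Qed.

(** The constant matrix has rank at most one, and since [K] maps the all-ones column to [k] times
    itself, [K] can be factored out of the difference without being inverted. Sylvester's identity
    then leaves a 1 by 1 determinant. *)
Lemma det_sub_const_rowsum (F : fieldType) (n : nat) (K : 'M[F]_n) (k c : F) :
  k != 0 -> K *m const_mx 1 = k *: const_mx 1 :> 'cV_n ->
  \det (K - const_mx c) = \det K * (1 - c * n%:R / k).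
Proof.
move=> k0 K1.
have -> : K - const_mx c =
    K *m (1%:M - (const_mx 1 : 'cV_n) *m (const_mx (c / k) : 'rV_n)).
  rewrite mulmxBr mulmx1 mulmxA K1; congr (_ - _).
  apply/matrixP=> i j; rewrite !mxE big_ord1 !mxE mulr1.
  by rewrite mulrC divfK.
rewrite det_mulmx det_sylvester det_mx11 !mxE eqxx; congr (_ * (1 - _)).
under eq_bigr do rewrite !mxE mulr1.
by rewrite sumr_const card_ord mulrAC mulr_natr.
Qed.

(** * Spectra of real symmetric matrices *)

Lemma char_poly_similar (F : fieldType) (n : nat) (P D : 'M[F]_n) :
  P \in unitmx -> char_poly (invmx P *m D *m P) = char_poly D.
Proof.
move=> uP; pose Q := map_mx polyC P; pose Q' := map_mx polyC (invmx P).
have QQ : Q' *m Q = 1%:M by rewrite -map_mxM mulVmx // map_mx1.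
have E : char_poly_mx (invmx P *m D *m P) = Q' *m char_poly_mx D *m Q.
  rewrite /char_poly_mx !map_mxM mulmxBr mulmxBl; congr (_ - _).
  by rewrite scalar_mxC -mulmxA QQ mulmx1.
rewrite /char_poly E !det_mulmx mulrAC -det_mulmx QQ det1.
by rewrite mul1r.
Qed.

(** Over the complex extension of [R] the matrix is Hermitian, so the spectral theorem diagonalizes
    it with real diagonal entries. Injectivity of the embedding of polynomials brings the
    factorization back to [R]. *)
Lemma char_poly_sym_split (R : rcfType) (n : nat) (M : 'M[R]_n) :
  M^T = M -> exists s : seq R, char_poly M = \prod_(z <- s) ('X - z%:P).
Proof.
move=> Msym; pose MC := map_mx (real_complex R) M.
have Creal (x : R) : (real_complex R x) \is Num.real by apply/complex_realP; exists x.
have MCh : MC \is hermsymmx.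
  apply: realsym_hermsym.
    apply/is_hermitianmxP; rewrite expr0 scale1r map_mx_id //.
    by rewrite /MC map_trmx Msym.
  by apply/mxOverP=> i j; rewrite mxE.
have /mxOverP dreal := hermitian_spectral_diag_real MCh.
have /hermitian_normalmx /orthomx_spectralP E := MCh.
have := char_poly_similar _ _ _ (diag_mx (spectral_diag MC)) (spectral_unit MC).
rewrite -E (char_poly_trig (diag_mx_is_trig _)) -(map_char_poly (real_complex R)) => EC.
exists [seq complex.Re (spectral_diag MC 0 i) | i <- enum 'I_n].
apply: (map_poly_inj (real_complex R)); rewrite EC rmorph_prod big_map big_enum.
apply: eq_bigr => i _; rewrite /= map_polyXsubC mxE eqxx mulr1n.
congr ('X - _%:P); exact/esym/RRe_real/dreal.
Qed.

(** Two lists are permutations of each other when every [z] occurs equally often in both; here both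
    counts are the multiplicity of [z] as a root of the characteristic polynomial. *)
Lemma eigenvalues_perm (R : rcfType) (n : nat) (M : 'M[R]_n) (s : seq R) :
  char_poly M = \prod_(z <- s) ('X - z%:P) -> perm_eq (eigenvalues M) s.
Proof.
move=> Ms; have M0 : char_poly M != 0 by rewrite monic_neq0 ?char_poly_monic.
rewrite /eigenvalues perm_sort; apply/allP => z _ /=; apply/eqP.
rewrite -[RHS]mu_prod_XsubC -Ms count_flatten -map_comp sumnE big_map.
under eq_bigr do rewrite /= count_nseq /=.
have rootsE : (z \in rootsR (char_poly M)) = root (char_poly M) z.
  by have /(_ z) := roots_on_rootsR M0; rewrite in_itv.
have [rz|nrz] := boolP (root (char_poly M) z); last first.
  rewrite mupNroot // big1_seq // => x /andP[_ xr].
  by case: eqP => [xz|]; rewrite ?mul0n // -rootsE -xz xr in nrz *.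
rewrite (bigD1_seq z) ?rootsE ?uniq_roots //= eqxx mul1n big1 ?addn0 //.
by move=> x /negPf; rewrite eq_sym => ->.
Qed.

Lemma char_poly_sym (R : rcfType) (n : nat) (M : 'M[R]_n) :
  M^T = M -> char_poly M = \prod_(z <- eigenvalues M) ('X - z%:P).
Proof.
move=> /char_poly_sym_split[s Ms]; rewrite Ms; apply: perm_big.
by rewrite perm_sym; apply: eigenvalues_perm.
Qed.

Lemma size_eigenvalues_sym (R : rcfType) (n : nat) (M : 'M[R]_n) :
  M^T = M -> size (eigenvalues M) = n.
Proof.
move=> /char_poly_sym /(congr1 (fun p : {poly R} => size p)).
by rewrite size_char_poly size_prod_XsubC => -[].
Qed.

(** The determinant is the characteristic polynomial of the mapped matrix evaluated at [y]. This
    allows [y] to be a rational function while the eigenvalues stay in [R]. *)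
Lemma det_scalar_sub_map (R F : fieldType) (f : {rmorphism R -> F}) (n : nat)
    (M : 'M[R]_n) (s : seq R) (y : F) :
  char_poly M = \prod_(z <- s) ('X - z%:P) ->
  \det (y%:M - map_mx f M) = \prod_(z <- s) (y - f z).
Proof.
move=> Ms; have -> : \det (y%:M - map_mx f M) = (char_poly (map_mx f M)).[y].
  rewrite -horner_evalE -det_map_mx; congr (\det _); apply/matrixP=> i j.
  by rewrite !mxE /= ?horner_evalE !(hornerE, hornerMn).
rewrite -map_char_poly Ms rmorph_prod horner_prod; apply: eq_bigr => z _.
by rewrite /= map_polyXsubC !hornerE.
Qed.

(** * Edges, degrees and the incidence matrix *)

Lemma sum_enum_val (R : nmodType) (T : finType) (F : T -> R) :
  \sum_(i < #|T|) F (enum_val i) = \sum_x F x.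
Proof. by rewrite [RHS](reindex _ (onW_bij _ (@enum_val_bij T))). Qed.

Section Graph.
Variable G : sgraph.
Implicit Types v w : G.

Lemma adj_neq v w : adj v w -> v != w.
Proof. by apply: contraTneq => ->; rewrite adj_irrefl. Qed.

Lemma card_edge (e : edge G) : #|val e| = 2%N.
Proof.
case: e => _ /= /imsetP[[v w] /= vw ->].
by rewrite inE in vw; rewrite cards2 adj_neq.
Qed.

Lemma edges_at v :
  [set e in edges G | v \in e] = [set [set v; w] | w in [set w | adj v w]].
Proof.
apply/setP=> e; rewrite inE; apply/andP/imsetP => [[/imsetP[[a b]]]|[w]].
  rewrite !inE /= => ab ->; rewrite !inE => /orP[]/eqP->.
    by exists b; rewrite ?inE.
  by exists a; rewrite ?inE 1?adj_sym // setUC.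
rewrite inE => vw ->; rewrite !inE eqxx; split=> //.
by apply/imsetP; exists (v, w); rewrite ?inE.
Qed.

Lemma card_edges_at v : #|[set e in edges G | v \in e]| = degree v.
Proof.
rewrite edges_at card_in_imset // => a b; rewrite !inE => va vb /setP/(_ a).
by rewrite !inE eqxx orbT eq_sym (negPf (adj_neq _ _ va)) /= => /esym/eqP.
Qed.

Lemma edges_at2 v w : v != w ->
  [set e in edges G | (v \in e) && (w \in e)] =
    if adj v w then [set [set v; w]] else set0.
Proof.
move=> vw; apply/setP=> e.
have -> : (e \in [set e in edges G | (v \in e) && (w \in e)]) =
    (e \in [set e in edges G | v \in e]) && (w \in e) by rewrite !inE andbA.
rewrite edges_at; apply/andP/idP => [[/imsetP[u]]|].
  rewrite !inE => vu ->; rewrite !inE eq_sym (negPf vw) /= => /eqP wu.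
  by rewrite wu vu inE.
case: ifP => [avw|]; rewrite inE // => /eqP ->; split; last by rewrite !inE eqxx orbT.
by apply/imsetP; exists w; rewrite ?inE.
Qed.

Lemma sum_edge (R : nmodType) (F : {set G} -> R) :
  \sum_(j < #|edge G|) F (val (enum_val j)) = \sum_(e in edges G) F e.
Proof. rewrite [RHS]big_sub; exact: (sum_enum_val _ (edge G) (fun e => F (val e))). Qed.

Definition incidence_mx (R : nzRingType) : 'M[R]_(#|G|, #|edge G|) :=
  \matrix_(i < #|G|, j < #|edge G|) (enum_val i \in val (enum_val j))%:R.

(** Entry (i, j) of the product counts the edges containing both vertices: the degree on the
    diagonal, and off it 1 or 0 according to adjacency, as two distinct vertices share at most one
    edge. *)
Lemma incidence_mul_tr (R : nzRingType) :
  incidence_mx R *m (incidence_mx R)^T = signless_laplacian R G.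
Proof.
apply/matrixP=> i j; rewrite !mxE.
pose F (e : {set G}) : R := ((enum_val i \in e) && (enum_val j \in e))%:R.
under eq_bigr do rewrite !mxE -natrM mulnb -/(F _).
rewrite sum_edge /F -natr_sum -big_mkcondr sum1dep_card.
have [<-|ij] := eqVneq i j.
  have -> : [set e in edges G | (enum_val i \in e) && (enum_val i \in e)] =
      [set e in edges G | enum_val i \in e] by apply/setP=> e; rewrite !inE andbb.
  by rewrite card_edges_at adj_irrefl addr0 mulr1n.
rewrite edges_at2 ?(inj_eq enum_val_inj) // mulr0n add0r.
by case: ifP; rewrite ?cards1 ?cards0.
Qed.

Lemma degree_sum v : degree v = (\sum_w adj v w)%N.
Proof. by rewrite /degree -sum1dep_card big_mkcond. Qed.

Lemma incidence_rowsum (R : nzRingType) i :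
  \sum_j incidence_mx R i j = (degree (enum_val i))%:R.
Proof.
under eq_bigr do rewrite mxE.
rewrite (sum_edge _ (fun e => (enum_val i \in e)%:R)) -natr_sum -big_mkcondr.
by rewrite sum1dep_card card_edges_at.
Qed.

Lemma incidence_colsum (R : nzRingType) j :
  \sum_i incidence_mx R i j = 2.
Proof.
under eq_bigr do rewrite mxE.
transitivity (#|val (enum_val j)|%:R : R); last by rewrite card_edge.
rewrite -natr_sum (sum_enum_val _ G (fun v => (v \in val (enum_val j)) : nat)).
by rewrite -big_mkcond sum1_card.
Qed.

End Graph.

(** * Signless Laplacian eigenvalues, and the largest one for a regular graph *)

(** At a coordinate where an eigenvector is largest in absolute value, the triangle inequality
    bounds the eigenvalue. Column sums appear because [eigenvalue] refers to row vectors. *)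
Lemma eigenvalue_le_colsum (R : realFieldType) (n : nat) (M : 'M[R]_n)
    (s a : R) :
  (forall i j, 0 <= M i j) -> (forall j, \sum_i M i j = s) ->
  eigenvalue M a -> a <= s.
Proof.
move=> M_ge0 Ms /eigenvalueP[v vM /rV0Pn[i0 vi0]].
case: (@arg_maxP _ _ _ i0 xpredT (fun i => `|v 0 i|)) => // i _ max_i.
have vi_gt0 : 0 < `|v 0 i| by apply: lt_le_trans (max_i i0 isT); rewrite normr_gt0.
rewrite -(ler_pM2r vi_gt0).
apply: (@le_trans _ _ `|a * v 0 i|); first by rewrite normrM ler_wpM2r // ler_norm.
have -> : a * v 0 i = \sum_j v 0 j * M j i.
  by move/rowP/(_ i): vM; rewrite !mxE => ->.
apply: le_trans (ler_norm_sum _ _ _) _; rewrite -(Ms i) mulr_suml.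
apply: ler_sum => j _; rewrite normrM (ger0_norm (M_ge0 _ _)) mulrC.
by rewrite ler_wpM2l //; apply: max_i.
Qed.

Lemma signless_laplacian_sym (R : nzRingType) (G : sgraph) :
  (signless_laplacian R G)^T = signless_laplacian R G.
Proof.
rewrite /signless_laplacian linearD /= tr_diag_mx; congr (_ + _).
by apply/matrixP=> i j; rewrite !mxE adj_sym.
Qed.

Lemma signless_laplacian_ge0 (R : numDomainType) (G : sgraph) i j :
  0 <= signless_laplacian R G i j.
Proof. by rewrite !mxE addr_ge0 ?mulrn_wge0 ?ler0n. Qed.

Lemma signless_laplacian_rowsum (R : nzRingType) (G : sgraph) i :
  \sum_j signless_laplacian R G i j = (2 * degree (enum_val i))%:R.
Proof.
under eq_bigr do rewrite !mxE.
rewrite big_split /= (bigD1 i) //= eqxx mulr1n big1 => [|j ji]; last first.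
  by rewrite eq_sym (negPf ji) mulr0n.
rewrite addr0 (sum_enum_val _ G (fun w => (adj (enum_val i) w)%:R)) -natr_sum.
by rewrite -degree_sum -natrD mul2n addnn.
Qed.

Lemma signless_laplacian_char_poly (R : rcfType) (G : sgraph) :
  char_poly (signless_laplacian R G) =
    \prod_(z <- eigenvalues (signless_laplacian R G)) ('X - z%:P).
Proof. exact/char_poly_sym/signless_laplacian_sym. Qed.

Lemma prod_nu (R : rcfType) (G : sgraph) (F : comNzRingType) (f : R -> F) :
  \prod_(z <- eigenvalues (signless_laplacian R G)) f z =
    \prod_(i < #|G|) f (nu R G i).
Proof.
rewrite (big_nth 0) big_mkord size_eigenvalues_sym //.
exact: signless_laplacian_sym.
Qed.

(** The all-ones vector shows that [2 * r] is an eigenvalue, and the column sum bound shows that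
    none is larger, so it stands last in the sorted list. *)
Lemma nu_regular_last (R : rcfType) (G : sgraph) (r : nat) :
  (0 < #|G|)%N -> regular G r -> nu R G #|G|.-1 = (2 * r)%:R.
Proof.
move=> G_gt0 rG; set Q := signless_laplacian R G; set d := (2 * r)%:R.
have Qsym : Q^T = Q := signless_laplacian_sym R G.
have rowQ i : \sum_j Q i j = d by rewrite signless_laplacian_rowsum rG.
have colQ j : \sum_i Q i j = d.
  by rewrite -(rowQ j); apply: eq_bigr => i _; rewrite -[in LHS]Qsym mxE.
have memQ a : (a \in eigenvalues Q) = eigenvalue Q a.
  by rewrite eigenvalue_root_char signless_laplacian_char_poly root_prod_XsubC.
have szQ : size (eigenvalues Q) = #|G| := size_eigenvalues_sym _ _ _ Qsym.
have dQ : d \in eigenvalues Q.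
  rewrite memQ; apply/eigenvalueP; exists (const_mx 1).
    apply/rowP=> j; rewrite !mxE mulr1 -(colQ j).
    by apply: eq_bigr => i _; rewrite mxE mul1r.
  by apply/rV0Pn; exists (Ordinal G_gt0); rewrite mxE oner_eq0.
apply/eqP; rewrite eq_le; apply/andP; split.
  apply: (eigenvalue_le_colsum _ _ Q) => //; first exact: signless_laplacian_ge0.
  by rewrite -memQ mem_nth // szQ prednK.
(* Conversely, [d] occurs somewhere in the sorted list, hence is at most its last entry. *)
have ltd : (index d (eigenvalues Q) < size (eigenvalues Q))%N by rewrite index_mem.
rewrite -[d](nth_index 0 dQ); apply: sorted_leq_nth.
- exact: le_trans.
- exact: le_refl.
- exact: sort_le_sorted.
- by [].
- by rewrite inE szQ prednK.
- by rewrite -ltnS prednK // -[X in (_ < X)%N]szQ.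
Qed.

Lemma prod_nu_regular (R : rcfType) (G : sgraph) (r : nat) (F : comNzRingType)
    (f : R -> F) :
  (0 < #|G|)%N -> regular G r ->
  \prod_(z <- eigenvalues (signless_laplacian R G)) f z =
    (\prod_(i < #|G|.-1) f (nu R G i)) * f (2 * r)%:R.
Proof.
move=> G_gt0 rG; rewrite prod_nu -(nu_regular_last R G r) //.
by case: #|G| G_gt0 => // n _; rewrite big_ord_recr.
Qed.

(** * Reordering of vertices and the determinant of the block matrix *)

(** Changing the enumeration permutes rows and columns alike, so the sign of the permutation enters
    squared. *)
Lemma det_reindex (R : comNzRingType) (T : finType) (p : nat) (g : 'I_p -> T)
    (f : T -> T -> R) :
  bijective g ->
  \det (\matrix_(i < #|T|, j < #|T|) f (enum_val i) (enum_val j)) =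
    \det (\matrix_(i, j) f (g i) (g j)).
Proof.
move=> bij_g; have Ep : #|T| = p by rewrite -(bij_eq_card bij_g) card_ord.
(* Identifying [p] with [#|T|] makes [enum_rank \o g] a self-map of one ordinal type, as [perm]
   requires. *)
case: _ / Ep in g bij_g *.
have inj_h : injective (enum_rank \o g).
  by apply: inj_comp; [exact: enum_rank_inj | exact: bij_inj].
pose s := perm inj_h.
have -> : \matrix_(i, j) f (g i) (g j) =
    row_perm s (col_perm s (\matrix_(i < #|T|, j < #|T|) f (enum_val i) (enum_val j))).
  by apply/matrixP=> i j; rewrite !mxE !permE /= !enum_rankK.
rewrite row_permE col_permE !det_mulmx !det_perm odd_permV mulrCA -expr2.
by rewrite sqrr_sign mulr1.
Qed.

(** The parameter [t] is the common row sum of [B^T *m B]. Both sides carry a factor that clears the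
    denominator [b - t / a] of the rank-one correction: on the left it is [a * b - t], on the right
    it is already multiplied in. *)
Lemma det_join_block (F : fieldType) (m n k : nat) (B : 'M[F]_(n, m))
    (C : 'M[F]_k) (a b t : F) :
  let one : 'cV[F]_k := const_mx 1 in
  let c := (one^T *m invmx C *m one) 0 0 in
  a != 0 -> b != 0 -> a * b - t != 0 -> C \in unitmx ->
  B^T *m B *m const_mx 1 = t *: const_mx 1 :> 'cV_m ->
  \det (block_mx b%:M (row_mx (- B^T) (const_mx (-1)))
          (col_mx (- B) (const_mx (-1))) (block_mx a%:M 0 0 C)) * (a * b - t) =
    b ^ (m%:Z - n%:Z) * \det C * \det ((a * b)%:M - B *m B^T)
      * (a * b - t - m%:R * a * c).
Proof.
move=> one c a0 b0 abt uC B1; set D := block_mx a%:M 0 0 C.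
have detD : \det D = a ^+ n * \det C by rewrite det_ublock det_scalar.
have uD : D \in unitmx.
  by rewrite unitmxE detD unitrM -unitmxE uC andbT unitfE expf_neq0.
have invD : invmx D = block_mx a^-1%:M 0 0 (invmx C).
  apply: (can_inj (mulmxK uD)); rewrite mulVmx // mulmx_block.
  rewrite !(mulmx0, mul0mx, addr0, add0r) -scalar_mxM mulVf // mulVmx //.
  by rewrite -scalar_mx_block.
(* Writing each constant block as an outer product with [one] isolates the scalar [c] in the middle;
   the two signs cancel. *)
have JCJ : const_mx (-1) *m invmx C *m const_mx (-1) = const_mx c :> 'M_m.
  have -> : const_mx (-1) = (const_mx (-1) : 'cV_m) *m one^T.
    by apply/matrixP=> i j; rewrite !mxE big_ord1 !mxE mulr1.
  have -> : const_mx (-1) = one *m (const_mx (-1) : 'rV_m).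
    by apply/matrixP=> i j; rewrite !mxE big_ord1 !mxE mul1r.
  rewrite -!mulmxA [one^T *m _]mulmxA [(_ *m _) *m _]mulmxA.
  rewrite [(_ *m _) *m one]mx11_scalar -/c.
  rewrite mul_scalar_mx -scalemxAr.
  by apply/matrixP=> i j; rewrite !mxE big_ord1 !mxE mulrNN !mulr1.
rewrite det_schur // detD invD mul_row_block mul_row_col.
rewrite !(mulmx0, mul0mx, addr0, add0r) JCJ mul_mx_scalar -scalemxAl.
rewrite mulNmx mulmxN opprK opprD addrA.
(* The matrix [b - a^-1 B^T B] has constant row sums [b - a^-1 * t], which is [(a * b - t) / a] and
   so nonzero. *)
rewrite (det_sub_const_rowsum _ _ _ (b - a^-1 * t)); first last.
- rewrite mulmxBl mul_scalar_mx -scalemxAl B1 scalerA -scalerBl //.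
- by apply: contraNneq abt => E; rewrite -(mulr0 a) -E; apply/eqP; field.
rewrite scalemxAl det_scalar_sub_mulmxC // -scalemxAr.
(* The factor [a ^+ n] of [\det D] is absorbed here. *)
have -> : \det ((a * b)%:M - B *m B^T) = a ^+ n * \det (b%:M - a^-1 *: (B *m B^T)).
  by rewrite -detZ scalerBr scalerA divff // scale1r scale_scalar_mx.
have ? : b - a^-1 * t != 0.
  by apply: contraNneq abt => E; rewrite -(mulr0 a) -E; apply/eqP; field.
have E : (1 - c * m%:R / (b - a^-1 * t)) * (a * b - t) = a * b - t - m%:R * a * c.
  by field; rewrite a0 mulrC.
by rewrite -E; ring.
Qed.

(** * Degrees and the characteristic matrix of the join *)

Section JoinDegrees.
Variables G1 G2 : sgraph.
Let J := subdivision_edge_join G1 G2.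

Lemma degree_join_orig (v : G1) : degree (inl (inl v) : J) = degree v.
Proof.
rewrite degree_sum !big_sumType /= -card_edges_at.
rewrite [X in (X + _ + _)%N]big1 // [X in (_ + _ + X)%N]big1 // add0n addn0.
by rewrite -sum1dep_card big_mkcondr [RHS]big_sub; apply: eq_bigr => e _; case: ifP.
Qed.

Lemma degree_join_inserted (e : edge G1) : degree (inl (inr e) : J) = (2 + #|G2|)%N.
Proof.
rewrite degree_sum !big_sumType /= -(card_edge _ e) [X in (_ + X + _)%N]big1 //.
by rewrite addn0 sum1_card -big_mkcond sum1_card.
Qed.

Lemma degree_join_right (w : G2) : degree (inr w : J) = (#|edge G1| + degree w)%N.
Proof.
rewrite degree_sum !big_sumType /= big1 // add0n sum1_card -degree_sum.
by [].
Qed.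

End JoinDegrees.

Lemma map_signless_laplacian (R S : nzRingType) (f : {rmorphism R -> S}) (G : sgraph) :
  map_mx f (signless_laplacian R G) = signless_laplacian S G.
Proof. by apply/matrixP=> i j; rewrite !mxE rmorphD !rmorphMn /= rmorph1. Qed.

(** Inserted vertices come first, unlike in the nested sum type, so that the Schur complement is
    taken on their block. *)
Definition join_vertex (G1 G2 : sgraph) (i : 'I_(#|edge G1| + (#|G1| + #|G2|))) :
    subdivision_edge_join G1 G2 :=
  match split i with
  | inl e => inl (inr (enum_val e))
  | inr j => match split j with
    | inl v => inl (inl (enum_val v))
    | inr w => inr (enum_val w)
    end
  end.

Lemma join_vertex_bij (G1 G2 : sgraph) : bijective (join_vertex G1 G2).
Proof.
exists (fun u : subdivision_edge_join G1 G2 => match u with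
  | inl (inr e) => unsplit (inl (enum_rank e))
  | inl (inl v) => unsplit (inr (unsplit (inl (enum_rank v))))
  | inr w => unsplit (inr (unsplit (inr (enum_rank w))))
  end) => [i|[[v|e]|w]]; rewrite /join_vertex ?unsplitK ?enum_rankK //.
rewrite -[RHS]splitK; case: (split i) => [e|j]; rewrite ?enum_valK //.
by rewrite -[j in RHS]splitK; case: (split j) => u; rewrite enum_valK.
Qed.

(** Inserted vertices are pairwise nonadjacent, as are original ones, so their diagonal blocks are
    diagonal. They are scalar because inserted vertices all have degree [2 + #|G2|] and original
    ones keep their degree [r]. *)
Lemma join_char_mx (F : comNzRingType) (G1 G2 : sgraph) (r : nat) (x : F) :
  regular G1 r ->
  \det (x%:M - signless_laplacian F (subdivision_edge_join G1 G2)) =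
    \det (block_mx (x - 2 - #|G2|%:R)%:M
            (row_mx (- (incidence_mx G1 F)^T) (const_mx (-1)))
            (col_mx (- incidence_mx G1 F) (const_mx (-1)))
            (block_mx (x - r%:R)%:M 0 0
               ((x - #|edge G1|%:R)%:M - signless_laplacian F G2))).
Proof.
move=> rG1; set J := subdivision_edge_join G1 G2.
(* Expressing the entries through vertices instead of indices makes [det_reindex] applicable. *)
pose h (u w : J) : F := x *+ (u == w) - ((degree u)%:R *+ (u == w) + (adj u w)%:R).
have -> : x%:M - signless_laplacian F J = \matrix_(i, j) h (enum_val i) (enum_val j).
  by apply/matrixP=> i j; rewrite !mxE /h (inj_eq enum_val_inj).
rewrite (det_reindex _ _ _ _ _ (join_vertex_bij G1 G2)); congr (\det _).
apply/matrixP=> i j; rewrite mxE /h /join_vertex.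
have inl_eq (S T : eqType) (u w : S) : (inl u == inl w :> S + T) = (u == w).
  by apply: inj_eq => ? ? [].
have inr_eq (S T : eqType) (u w : T) : (inr u == inr w :> S + T) = (u == w).
  by apply: inj_eq => ? ? [].
case: (split_ordP i) => [{}i ->|{}i ->]; case: (split_ordP j) => [{}j ->|{}j ->];
  rewrite ?block_mxEul ?block_mxEur ?block_mxEdl ?block_mxEdr.
- rewrite degree_join_inserted /= !inl_eq !inr_eq (inj_eq enum_val_inj) !mxE.
  by rewrite addr0 -mulrnBl natrD opprD addrA.
- case: (split_ordP j) => {}j ->; rewrite ?row_mxEl ?row_mxEr !mxE /=.
    by rewrite !mulr0n sub0r add0r.
  by rewrite !mulr0n sub0r add0r.
- case: (split_ordP i) => {}i ->; rewrite ?col_mxEu ?col_mxEd !mxE /=.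
    by rewrite !mulr0n sub0r add0r.
  by rewrite !mulr0n sub0r add0r.
case: (split_ordP i) => {}i ->; case: (split_ordP j) => {}j ->;
  rewrite ?block_mxEul ?block_mxEur ?block_mxEdl ?block_mxEdr !mxE /=.
- rewrite degree_join_orig rG1 !inl_eq (inj_eq enum_val_inj).
  by rewrite addr0 -mulrnBl.
- by rewrite !mulr0n !addr0 oppr0 ?addr0.
- by rewrite !mulr0n !addr0 oppr0 ?addr0.
rewrite degree_join_right !inr_eq (inj_eq enum_val_inj) natrD mulrnDl mulrnBl.
by rewrite !opprD !addrA.
Qed.

(** * Assembly over the field of rational functions *)

Theorem theorem3p9 (R : rcfType) (G1 G2 : sgraph) (n1 m1 r1 n2 : nat)
    (n1_gt0 : (0 < n1)%N) (n2_gt0 : (0 < n2)%N)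
    (cardG1 : #|G1| = n1) (edgesG1 : #|edges G1| = m1)
    (regG1 : regular G1 r1) (cardG2 : #|G2| = n2) :
  let x : {fraction {poly R}} := 'X%:F in
  (char_poly (signless_laplacian R (subdivision_edge_join G1 G2)))%:F =
    (x - 2 - n2%:R) ^ (m1%:Z - n1%:Z)
    * (\prod_(i < n2) (x - m1%:R - (nu R G2 i)%:P%:F))
    * (\prod_(i < n1.-1)
         (x ^+ 2 - (2 + r1%:R + n2%:R) * x + r1%:R * n2%:R + 2 * r1%:R
          - (nu R G1 i)%:P%:F))
    * (x ^+ 2 - (2 + r1%:R + n2%:R) * x + r1%:R * n2%:R
       - m1%:R * (x - r1%:R)
         * coronal (signless_laplacian R G2) (x - m1%:R)).
Proof.
move=> x; subst n1 n2.
have {edgesG1} edgeG1 : #|edge G1| = m1 by rewrite card_sig -edgesG1; apply: eq_card.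
subst m1.
pose f : {rmorphism R -> {fraction {poly R}}} := @tofrac {poly R} \o polyC.
have x_nat k : x - k%:R = ('X - (k%:R)%:P)%:F by rewrite tofracB !rmorph_nat.
pose a := x - r1%:R; pose b := x - 2 - #|G2|%:R.
pose t : {fraction {poly R}} := (2 * r1)%:R.
pose C := (x - #|edge G1|%:R)%:M - signless_laplacian {fraction {poly R}} G2.
have b_nat : b = x - (2 + #|G2|)%:R by rewrite natrD opprD addrA.
have a0 : a != 0 by rewrite /a x_nat tofrac_eq0 polyXsubC_eq0.
have b0 : b != 0 by rewrite b_nat x_nat tofrac_eq0 polyXsubC_eq0.
(* A product of two monic linear polynomials has size 3 and cannot equal the constant [t]. *)
have abt : a * b - t != 0.
  rewrite b_nat /a !x_nat -tofracM subr_eq0.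
  have -> : t = ((2 * r1)%:R%:P)%:F by rewrite !rmorph_nat.
  rewrite tofrac_eq; apply: contraTneq isT => /(congr1 (fun p : {poly R} => size p)).
  rewrite size_mul ?polyXsubC_eq0 // !size_XsubC => E.
  by have := size_polyC_leq1 ((2 * r1)%:R : R); rewrite -E.
have detC : \det C = \prod_(i < #|G2|) (x - #|edge G1|%:R - (nu R G2 i)%:P%:F).
  rewrite /C -(map_signless_laplacian _ _ f).
  rewrite (det_scalar_sub_map _ _ _ _ _ _ _ (signless_laplacian_char_poly R G2)).
  by rewrite (prod_nu R G2 _ (fun z => x - #|edge G1|%:R - f z)).
(* By [detC] the determinant is a product of monic linear polynomials in [x], none of them zero. *)
have uC : C \in unitmx.
  rewrite unitmxE unitfE detC; apply/prodf_neq0 => i _.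
  by rewrite x_nat -tofracB -addrA -opprD -polyCD tofrac_eq0 polyXsubC_eq0.
(* The eigenvalue [2 * r1] contributes the separate factor [a * b - t]. *)
have detG1 : \det ((a * b)%:M - signless_laplacian {fraction {poly R}} G1) =
    (\prod_(i < #|G1|.-1) (a * b - (nu R G1 i)%:P%:F)) * (a * b - t).
  rewrite -(map_signless_laplacian _ _ f).
  rewrite (det_scalar_sub_map _ _ _ _ _ _ _ (signless_laplacian_char_poly R G1)).
  rewrite (prod_nu_regular R G1 r1 _ (fun z => a * b - f z)) //.
  by rewrite rmorph_nat.
set B := incidence_mx G1 {fraction {poly R}}.
have B1 : B^T *m B *m const_mx 1 = t *: const_mx 1 :> 'cV_#|edge G1|.
  have E1 : B *m const_mx 1 = r1%:R *: const_mx 1 :> 'cV_#|G1|.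
    apply/colP=> i; rewrite !mxE mulr1 -(regG1 (enum_val i)) -incidence_rowsum.
    by apply: eq_bigr => j _; rewrite !mxE mulr1.
  have E2 : B^T *m const_mx 1 = 2 *: const_mx 1 :> 'cV_#|edge G1|.
    apply/colP=> i; rewrite !mxE mulr1 -(incidence_colsum G1 _ i).
    by apply: eq_bigr => j _; rewrite !mxE mulr1.
  by rewrite -mulmxA E1 -scalemxAr E2 scalerA /t natrM mulrC.
have -> : (char_poly (signless_laplacian R (subdivision_edge_join G1 G2)))%:F =
    \det (x%:M - signless_laplacian {fraction {poly R}} (subdivision_edge_join G1 G2)).
  rewrite -det_map_mx -(map_signless_laplacian _ _ f); congr (\det _).
  by apply/matrixP=> i j; rewrite !mxE rmorphB rmorphMn.
(* The factor introduced here matches the left side of [det_join_block]; on the right it reappears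
   through [detG1]. *)
apply: (mulIf abt).
rewrite (join_char_mx _ _ _ _ _ regG1).
rewrite (det_join_block _ _ _ _ B C a b t a0 b0 abt uC B1) incidence_mul_tr detG1 detC.
have -> : coronal (signless_laplacian R G2) (x - #|edge G1|%:R) =
    ((const_mx 1)^T *m invmx C *m const_mx 1 : 'M_1) 0 0.
  by rewrite /coronal /C -(map_signless_laplacian _ _ f).
have abE z : a * b - z =
    x ^+ 2 - (2 + r1%:R + #|G2|%:R) * x + r1%:R * #|G2|%:R + 2 * r1%:R - z.
  by rewrite /a /b; ring.
have -> : \prod_(i < #|G1|.-1) (x ^+ 2 - (2 + r1%:R + #|G2|%:R) * x
      + r1%:R * #|G2|%:R + 2 * r1%:R - (nu R G1 i)%:P%:F) =
    \prod_(i < #|G1|.-1) (a * b - (nu R G1 i)%:P%:F).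
  by apply: eq_bigr => i _; rewrite abE.
(* The last quadratic of the statement lacks the term [2 * r1], which is exactly [t]. *)
have -> : x ^+ 2 - (2 + r1%:R + #|G2|%:R) * x + r1%:R * #|G2|%:R = a * b - t.
  by rewrite abE /t natrM addrK.
by rewrite -/a -/b !mulrA mulrAC.
Qed.
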